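(* For every stratified formula $\varphi$ in the enriched syntax there is an injective map $r$ from the set of variables appearing in $\varphi$ to the set $\{v_n^m\mid n,m\in\mathbb{N}\}$ of all variables such that the formula obtained from $\varphi$ by replacing every occurrence of each variable $x$ by $r(x)$ is exo-stratified. That is, every stratified formula is, up to a renaming of variables, an exo-stratified formula.
   Context: Enriched syntax of set theory: the alphabet consists of the symbols $[$, $]$, $\to$, $\forall$, $\doteq$ (equality symbol), $\in$, $v$, $\circledast$, $\star$, $\bot$. The variables are the strings $v_n^m := v\circledast^n\star^m$ for $n,m\in\mathbb{N}$ ($v$ followed by $n$ copies of $\circledast$ and then $m$ copies of $\star$). The atomic formulae are $\bot$ and the strings $\alpha\doteq\beta$ and $\alpha\in\beta$ for variables $\alpha,\beta$. Every atomic formula is a formula, and if $\varphi,\psi$ are formulae and $\alpha$ is a variable then $[\varphi\to\psi]$ and $[\forall\alpha]\varphi$ are formulae. Stratification: let $\varphi$ be a formula and $X$ the set of variables appearing in $\varphi$. A stratification of $\varphi$ is a function $\sigma\colon X\to\mathbb{Z}$ such that whenever $x\in y$ appears as a subformula of $\varphi$, $\sigma(x)=\sigma(y)-1$, and whenever $x\doteq y$ appears as a subformula of $\varphi$, $\sigma(x)=\sigma(y)$. A formula is stratified if it has a stratification. A formula $\varphi$ in the enriched syntax is exo-stratified if: (1) whenever $v_{n_1}^{m_1}\doteq v_{n_2}^{m_2}$ appears as a subformula of $\varphi$, $m_1=m_2$; and (2) whenever $v_{n_1}^{m_1}\in v_{n_2}^{m_2}$ appears as a subformula of $\varphi$, $m_1=m_2-1$.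 *)

(* Defs.v *)
From HB Require Import structures.
From mathcomp Require Import all_boot all_order all_algebra.
Set Implicit Arguments. Unset Strict Implicit. Unset Printing Implicit Defensive.
Import Order.TTheory GRing.Theory Num.Theory.
Local Open Scope ring_scope.

(* [Var n m] stands for the string v_n^m, that is "v" followed by n copies of
   the circled asterisk and then m copies of the star; distinct pairs (n, m)
   give distinct strings. *)
Record variable := Var { lower : nat; upper : nat }.

Definition pair_of_variable (x : variable) : nat * nat := (lower x, upper x).
Definition variable_of_pair (p : nat * nat) : variable := Var p.1 p.2.

Lemma pair_of_variableK : cancel pair_of_variable variable_of_pair.
Proof. by case. Qed.

HB.instance Definition _ := Countable.copy variable (can_type pair_of_variableK).

(* The strings of the grammar are uniquely readable, so formulae are represented
   by their syntax trees: [fImp phi psi] is the string "[phi -> psi]" and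
   [fAll a phi] is the string "[forall a]phi". *)
Inductive formula :=
| fBot
| fEq (a b : variable)
| fMem (a b : variable)
| fImp (phi psi : formula)
| fAll (a : variable) (phi : formula).

(* A quantified variable appears in the formula even if it is not used
   in the scope of its quantifier. *)
Fixpoint vars (phi : formula) : seq variable :=
  match phi with
  | fBot => [::]
  | fEq a b | fMem a b => [:: a; b]
  | fImp phi psi => vars phi ++ vars psi
  | fAll a phi => a :: vars phi
  end.

(* Every occurrence is replaced, free, bound or binding. *)
Fixpoint rename (r : variable -> variable) (phi : formula) : formula :=
  match phi with
  | fBot => fBot
  | fEq a b => fEq (r a) (r b)
  | fMem a b => fMem (r a) (r b)
  | fImp phi psi => fImp (rename r phi) (rename r psi)
  | fAll a phi => fAll (r a) (rename r phi)
  end.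

Inductive subformula (chi : formula) : formula -> Prop :=
| sub_refl : subformula chi chi
| sub_impl phi psi : subformula chi phi -> subformula chi (fImp phi psi)
| sub_impr phi psi : subformula chi psi -> subformula chi (fImp phi psi)
| sub_all a phi : subformula chi phi -> subformula chi (fAll a phi).

(* A function on the variables appearing in phi is represented by a total
   function; its values at other variables play no role here, since the
   variables of a subformula of phi appear in phi. *)
Definition stratification (phi : formula) (sigma : variable -> int) : Prop :=
  (forall x y, subformula (fMem x y) phi -> sigma x = sigma y - 1) /\
  (forall x y, subformula (fEq x y) phi -> sigma x = sigma y).

Definition stratified (phi : formula) : Prop :=
  exists sigma : variable -> int, stratification phi sigma.

(* The second equation is over the integers: with truncated subtraction on nat
   it would wrongly accept m1 = m2 = 0. *)
Definition exo_stratified (phi : formula) : Prop :=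
  (forall n1 m1 n2 m2 : nat,
     subformula (fEq (Var n1 m1) (Var n2 m2)) phi -> m1 = m2) /\
  (forall n1 m1 n2 m2 : nat,
     subformula (fMem (Var n1 m1) (Var n2 m2)) phi -> m1%:Z = m2%:Z - 1).

(* Main.v *)
(** Shift a stratification by a constant so that it is nonnegative on the
    finitely many variables of the formula, and use the shifted level as the
    number of stars. The number of other symbols is free, so a code of the
    original variable stored there makes the renaming injective. *)
Require Import Defs.
From mathcomp Require Import all_boot all_order all_algebra.
From mathcomp Require Import zify.

(** Renaming acts node by node, so atoms of a renamed formula pull back to atoms of the original,
    where a stratification constrains them. *)
Lemma subformula_rename (r : variable -> variable) (chi phi : formula) :
  subformula chi (rename r phi) ->
  exists2 chi', subformula chi' phi & chi = rename r chi'.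
Proof.
elim: phi => [|a b|a b|phi IHphi psi IHpsi|a phi IHphi] /= sub_chi;
  inversion sub_chi as [|? ? sub|? ? sub|? ? sub]; subst.
- by exists fBot => //; constructor.
- by exists (fEq a b) => //; constructor.
- by exists (fMem a b) => //; constructor.
- by exists (fImp phi psi) => //; constructor.
- by have [chi' sub' ->] := IHphi sub; exists chi' => //; apply: sub_impl.
- by have [chi' sub' ->] := IHpsi sub; exists chi' => //; apply: sub_impr.
- by exists (fAll a phi) => //; constructor.
- by have [chi' sub' ->] := IHphi sub; exists chi' => //; apply: Defs.sub_all.
Qed.

Lemma subformula_vars (chi phi : formula) :
  subformula chi phi -> {subset vars chi <= vars phi}.
Proof.
elim=> [|phi1 phi2 _ IH|phi1 phi2 _ IH|a phi1 _ IH] x //= /IH x_phi.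
- by rewrite mem_cat x_phi.
- by rewrite mem_cat x_phi orbT.
- by rewrite inE x_phi orbT.
Qed.

Theorem mainTheorem4 (phi : formula) (phi_strat : stratified phi) :
  exists r : variable -> variable,
    {in vars phi &, injective r} /\ exo_stratified (rename r phi).
Proof.
have [sigma [sigma_mem sigma_eq]] := phi_strat.
pose c := \max_(x <- vars phi) `|sigma x|%N.
have c_ge x : x \in vars phi -> (`|sigma x| <= c)%N.
  by move=> x_phi; apply: leq_bigmax_seq.
exists (fun x => Var (pickle x) (absz (sigma x + c%:Z)%R)).
split; first by move=> x y _ _ [/(pcan_inj pickleK)].
(* Renaming keeps the head constructor: equalities come only from equalities, memberships only from
   memberships. *)
split=> n1 m1 n2 m2 /subformula_rename[[|a b|a b|psi chi|a psi] sub] //=.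
  by case=> _ -> _ ->; rewrite (sigma_eq _ _ sub).
have [a_phi b_phi] : a \in vars phi /\ b \in vars phi.
  by split; apply: (subformula_vars _ _ sub); rewrite !inE eqxx ?orbT.
case=> _ -> _ ->.
(* The bounds by [c] make both shifted levels nonnegative, so [absz] preserves their difference of
   one. *)
have := sigma_mem _ _ sub; have := c_ge _ a_phi; have := c_ge _ b_phi.
lia.
Qed.
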